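(* Let $n,p\ge1$ be integers, let $y\in\{0,1\}^n$, let $Q\in\mathbb{R}^{p\times p}$ be symmetric positive definite, let $v\in\mathbb{R}^p$, and let $X\in\mathbb{R}^{n\times p}$ have full column rank if $n\ge p$ and full row rank if $n<p$. Suppose that at least one of the following holds: (A) all eigenvalues (if $n\ge p$), or all non-zero eigenvalues (if $n<p$), of $Q^{-1/2}X^TXQ^{-1/2}$ are less than $7/2$; (B) $XQ^{-1/2}$ is rectangular diagonal, i.e. its $(i,j)$ entry is $0$ whenever $i\ne j$. Then the Albert–Chib data augmentation (AC-DA) Markov chain $\Psi$ on $\mathbb{R}^p$ determined by $(X,y,Q,v)$ is trace-class, i.e. its transition density $k$ satisfies $$\int_{\mathbb{R}^p}k(\beta,\beta)\,d\beta<\infty .$$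
   Context: $Q^{-1/2}$ denotes the symmetric positive definite square root of $Q^{-1}$. Setting (Bayesian probit regression with proper normal prior). $X$ is an $n\times p$ real matrix whose $i$th row is $x_i^T$, $x_i\in\mathbb{R}^p$; $y=(y_1,\dots,y_n)^T\in\{0,1\}^n$ is the observed data; the prior on $\beta\in\mathbb{R}^p$ is $N_p(Q^{-1}v,Q^{-1})$. Let $\mathcal{Z}\subset\mathbb{R}^n$ be the Cartesian product of the $n$ half lines, the $i$th being $(0,\infty)$ if $y_i=1$ and $(-\infty,0]$ if $y_i=0$. Two conditional densities are used: - $\pi(\beta\mid z,y)$, for $z\in\mathcal{Z}$, is the density in $\beta$ of $N_p\big((X^TX+Q)^{-1}(v+X^Tz),\,(X^TX+Q)^{-1}\big)$. - $\pi(z\mid\beta,y)$, for $\beta\in\mathbb{R}^p$, is the density on $\mathcal{Z}$ under which $z_1,\dots,z_n$ are independent and $z_i$ has the $N(x_i^T\beta,1)$ distribution truncated to $(0,\infty)$ if $y_i=1$ and to $(-\infty,0]$ if $y_i=0$. The AC-DA Markov chain $\Psi=(\beta_m)_{m\ge0}$ moves from current state $\beta'$ by drawing $z\sim\pi(\cdot\mid\beta',y)$ and then the new state $\beta\sim\pi(\cdot\mid z,y)$; its transition density is $k(\beta',\beta)=\int_{\mathcal{Z}}\pi(\beta\mid z,y)\,\pi(z\mid\beta',y)\,dz$. The chain (equivalently its Markov operator on the mean-zero square-integrable functions with respect to the posterior) is called trace-class if $\int_{\mathbb{R}^p}k(\beta,\beta)\,d\beta<\infty$. *)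

(* Defs.v *)
From HB Require Import structures.
From mathcomp Require Export all_boot all_order all_algebra.
From mathcomp Require Export all_classical all_reals all_analysis.
From mathcomp Require Export measurable_realfun.
Set Implicit Arguments.
Unset Strict Implicit.
Unset Printing Implicit Defensive.
Import Order.TTheory GRing.Theory Num.Theory.
Import numFieldNormedType.Exports.
Local Open Scope classical_set_scope.
Local Open Scope ring_scope.

(* The library has the product sigma-algebra on [n.-tuple T] but no product
   measure on it; the Lebesgue measure on R^n is built here by iterating the
   binary product measure [\x]. *)
Section lebesgue_tuple.
Variable R : realType.
Local Notation RT := (measurableTypeR R).
Local Notation lebesgue := (@lebesgue_measure R : set RT -> \bar R).

Definition tuple_cons n (x : RT * n.-tuple RT) : n.+1.-tuple RT :=
  [tuple of x.1 :: x.2].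

Lemma measurable_tuple_cons n : measurable_fun setT (@tuple_cons n).
Proof. exact: measurable_cons. Qed.

Section step.
Variables (n : nat) (mu : {sigma_finite_measure set (n.-tuple RT) -> \bar R}).

Definition lebesgue_tuple_cons : set (n.+1.-tuple RT) -> \bar R :=
  pushforward (lebesgue \x mu)%E (@tuple_cons n).

HB.instance Definition _ := Measure.copy lebesgue_tuple_cons
  (measure_function_pushforward__canonical__measure_function_Measure
     (lebesgue \x mu)%E (@measurable_tuple_cons n)).

Let sigma_finite_lebesgue_tuple_cons : sigma_finite setT lebesgue_tuple_cons.
Proof.
have /sigma_finiteP[F [TF ndF Foo]] := sigma_finiteT (@lebesgue_measure R).
have /sigma_finiteP[G [TG ndG Goo]] := sigma_finiteT mu.
pose hd (t : n.+1.-tuple RT) : RT := tnth t ord0.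
pose tl (t : n.+1.-tuple RT) : n.-tuple RT := [tuple of behead t].
exists (fun k => hd @^-1` F k `&` tl @^-1` G k).
  apply/esym/seteqP; split => // t _.
  have [i _ Fi] : (\bigcup_i F i) (hd t) by rewrite -TF.
  have [j _ Gj] : (\bigcup_i G i) (tl t) by rewrite -TG.
  exists (maxn i j) => //; split.
    by have /subsetPset := ndF _ _ (leq_maxl i j); exact.
  by have /subsetPset := ndG _ _ (leq_maxr i j); exact.
move=> k; have [mF Fk] := Foo k; have [mG Gk] := Goo k; split.
  apply: measurableI; rewrite -[X in measurable X]setTI.
    exact: (@measurable_tnth _ RT n.+1 ord0 measurableT _ mF).
  exact: (@measurable_behead _ RT n measurableT _ mG).
rewrite /lebesgue_tuple_cons /pushforward.
rewrite (_ : _ @^-1` _ = F k `*` G k).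
  by rewrite product_measure1E// lte_mul_pinfty// ge0_fin_numE.
apply/seteqP; split => -[x t]; rewrite /hd /tl /=.
  by move=> [Fx]; rewrite (_ : [tuple of _] = t)//; exact: val_inj.
by move=> [Fx Gt]; split=> //; rewrite (_ : [tuple of _] = t)//; exact: val_inj.
Qed.

HB.instance Definition _ := Measure_isSigmaFinite.Build _ _ _
  lebesgue_tuple_cons sigma_finite_lebesgue_tuple_cons.
End step.

Fixpoint lebesgue_tuple n : {sigma_finite_measure set (n.-tuple RT) -> \bar R} :=
  match n with
  | 0 => dirac ([tuple] : 0.-tuple RT)
  | m.+1 => lebesgue_tuple_cons (lebesgue_tuple m)
  end.
End lebesgue_tuple.
Arguments lebesgue_tuple {R} n.

Section matrices.
Variable R : realType.

Definition col_of_tuple n (t : n.-tuple (measurableTypeR R)) : 'cV[R]_n :=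
  \col_i tnth t i.

Definition spdmx n (A : 'M[R]_n) : Prop :=
  A^T = A /\ forall u : 'cV[R]_n, u != 0 -> 0 < (u^T *m A *m u) 0 0.

(* The symmetric positive definite S with S^2 = Q^-1; for symmetric positive
   definite Q there is exactly one. *)
Definition is_invsqrtmx n (Q S : 'M[R]_n) : Prop :=
  spdmx S /\ S *m S = invmx Q.

Definition rect_diagonal m n (A : 'M[R]_(m, n)) : Prop :=
  forall (i : 'I_m) (j : 'I_n), (i : nat) <> (j : nat) -> A i j = 0.

(* Density of N_n(m, S), S being the covariance matrix. *)
Definition mvnormal_pdf n (m : 'cV[R]_n) (S : 'M[R]_n) (x : 'cV[R]_n) : R :=
  expR (- ((x - m)^T *m invmx S *m (x - m)) 0 0 / 2) /
  Num.sqrt ((2 * pi) ^+ n * \det S).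

(* Density of N(m, 1) conditioned on A; [normal_pdf] and [normal_prob] take the
   standard deviation as second argument. *)
Definition trunc_normal_pdf (m : R) (A : set R) (x : R) : R :=
  normal_pdf m 1 x / fine (normal_prob m 1 A) * \1_A x.
End matrices.

Section acda.
Variables (R : realType) (n p : nat).
Variables (X : 'M[R]_(n, p)) (y : n.-tuple bool).
Variables (Q : 'M[R]_p) (v : 'cV[R]_p).

Definition half_line (b : bool) : set R :=
  if b then `]0, +oo[%classic else `]-oo, 0]%classic.

Definition latent_space : set (n.-tuple (measurableTypeR R)) :=
  [set z | forall i, half_line (tnth y i) (tnth z i)].

Definition beta_pdf (z : 'cV[R]_n) (b : 'cV[R]_p) : R :=
  let P := X^T *m X + Q in
  mvnormal_pdf (invmx P *m (v + X^T *m z)) (invmx P) b.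

Definition latent_pdf (b : 'cV[R]_p) (z : 'cV[R]_n) : R :=
  \prod_(i < n)
    trunc_normal_pdf ((X *m b) i 0) (half_line (tnth y i)) (z i 0).

Definition acda_kernel (b' b : 'cV[R]_p) : \bar R :=
  (\int[lebesgue_tuple n]_(z in latent_space)
     (beta_pdf (col_of_tuple z) b * latent_pdf b' (col_of_tuple z))%:E)%E.
End acda.

Definition trace_class (R : realType) (p : nat)
    (k : 'cV[R]_p -> 'cV[R]_p -> \bar R) : Prop :=
  (\int[lebesgue_tuple p]_b k (col_of_tuple b) (col_of_tuple b) < +oo)%E.

(* Main.v *)
(** Write [P = X^T X + Q], [u = X b], [w] for the projection of [u] onto the
product of the closed half-lines, and [s = b - P^-1 (v + X^T z)].  On the latent
space, [(z_i - u_i)^2 >= (z_i - w_i)^2 + (u_i - w_i)^2], and the second square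
compensates the decay of the truncation mass up to a factor [exp |u_i|], so the
integrand of [k(b, b)] is at most a constant times
[exp (- (s^T P s + |z - w|^2) / 2 + |u|_1)].  Since
[b^T Q b + u^T (u - w) = b^T P s + b^T v + u^T (z - w)] and [u^T (u - w) >= 0],
AM-GM gives [s^T P s + |z - w|^2 >= c |b|^2 - K].  The integrand is thus
dominated by a Gaussian in [(b, z - w)], whose integral factorizes. *)
Require Import Defs.
From mathcomp Require Import all_boot all_order all_algebra.
From mathcomp Require Import all_classical all_reals all_analysis.
From mathcomp Require Import ring lra.
Set Implicit Arguments.
Unset Strict Implicit.
Unset Printing Implicit Defensive.
Import Order.TTheory GRing.Theory Num.Theory.
Import numFieldNormedType.Exports.
Local Open Scope ring_scope.

(** * Integration over [R^n]: comparison, Tonelli, products and Gaussians *)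

(** The integral of a nonnegative function is a supremum over the simple functions below it, so
    monotonicity is inclusion of the two families. This form applies to the kernel, whose
    measurability is never established. *)
Lemma ge0_le_integral_nomeas d (T : measurableType d) (R : realType)
    (mu : {measure set T -> \bar R}) (D : set T) (f g : T -> \bar R) :
  (forall x, D x -> 0 <= f x)%E -> (forall x, 0 <= g x)%E ->
  (forall x, D x -> f x <= g x)%E ->
  (\int[mu]_(x in D) f x <= \int[mu]_x g x)%E.
Proof.
move=> f0 g0 fg; rewrite !ge0_integralE//; apply: ereal_sup_le.
move=> _ [h hf <-]; exists h => // x; apply: le_trans (hf x) _.
rewrite patch_setT /patch; case: ifPn => [|_]; last exact: g0.
by rewrite inE; exact: fg.
Qed.

Lemma integral_lebesgue_tupleS (R : realType) n
    (g : n.+1.-tuple (measurableTypeR R) -> \bar R) :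
  measurable_fun setT g -> (forall t, 0 <= g t)%E ->
  (\int[lebesgue_tuple n.+1]_t g t =
   \int[lebesgue_measure]_x \int[lebesgue_tuple n]_t g (tuple_cons (x, t)))%E.
Proof.
move=> mg g0.
rewrite [LHS](@ge0_integral_pushforward _ _ _ _ _ _ (@measurable_tuple_cons R n))//.
rewrite preimage_setT fubini_tonelli1//.
  by apply: measurableT_comp => //; exact: measurable_tuple_cons.
by move=> x; exact: g0.
Qed.

Lemma measurable_prod_tnth (R : realType) n (f : 'I_n -> measurableTypeR R -> R) :
  (forall i, measurable_fun setT (f i)) ->
  measurable_fun setT
    (fun t : n.-tuple (measurableTypeR R) => \prod_(i < n) f i (tnth t i)).
Proof.
move=> mf; apply: measurable_prod => i _.
by apply: measurableT_comp => //; exact: measurable_tnth.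
Qed.

(** The factors may differ as long as they share the integral [M]: they will be Gaussians of one
    width around different centres. *)
Lemma integral_lebesgue_tuple_prod (R : realType) n
    (f : 'I_n -> measurableTypeR R -> R) (M : R) :
  0 <= M -> (forall i x, 0 <= f i x) ->
  (forall i, measurable_fun setT (f i)) ->
  (forall i, \int[lebesgue_measure]_x (f i x)%:E = M%:E)%E ->
  (\int[lebesgue_tuple n]_t (\prod_(i < n) f i (tnth t i))%:E = (M ^+ n)%:E)%E.
Proof.
move=> M0; elim: n f => [|n IHn] f f0 mf fM.
  (* In dimension 0 the measure is a unit mass at the empty tuple, matching [M ^+ 0 = 1]. *)
  rewrite [LHS]integral_dirac//.
    by rewrite big_ord0 expr0 diracT mul1e.
  by apply/measurable_EFinP; exact: measurable_prod_tnth.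
rewrite integral_lebesgue_tupleS; last 2 first.
- by apply/measurable_EFinP; exact: measurable_prod_tnth.
- by move=> t; rewrite lee_fin prodr_ge0.
have prod_cons x t : \prod_(i < n.+1) f i (tnth (tuple_cons (x, t)) i) =
    f ord0 x * \prod_(i < n) f (lift ord0 i) (tnth t i).
  rewrite big_ord_recl; congr (_ * _).
  by apply: eq_bigr => i _; rewrite tnthS.
under eq_integral => x _.
  under eq_integral do rewrite prod_cons EFinM.
  rewrite ge0_integralZl_EFin//; last 2 first.
  - by move=> t _; rewrite lee_fin prodr_ge0.
  - apply/measurable_EFinP.
    exact: (measurable_prod_tnth (fun i => mf (lift ord0 i))).
  rewrite (IHn (fun i => f (lift ord0 i)))//.
  over.
rewrite ge0_integralZr//=; first by rewrite fM -EFinM -exprS.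
- by apply/measurable_EFinP; exact: mf.
- by move=> x _; rewrite lee_fin.
- by rewrite lee_fin exprn_ge0.
Qed.

Lemma integral_gauss_pos (R : realType) (a m : R) : 0 < a ->
  (\int[lebesgue_measure]_x (expR (- (a * (x - m) ^+ 2)))%:E =
   (Num.sqrt (pi / a))%:E)%E.
Proof.
(* The standard deviation with [1 / (2 s^2) = a]: the integrand is [normal_pdf m s] divided by its
   peak. *)
move=> a0; pose s := Num.sqrt (a *+ 2)^-1.
have s2 : s ^+ 2 = (a *+ 2)^-1 by rewrite sqr_sqrtr// invr_ge0 mulrn_wge0// ltW.
have s0 : s != 0 by rewrite gt_eqF// sqrtr_gt0 invr_gt0 mulrn_wgt0.
have peakE : (normal_peak s)^-1 = Num.sqrt (pi / a).
  rewrite /normal_peak invrK s2; congr Num.sqrt.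
  by field; rewrite gt_eqF.
rewrite -peakE -[RHS]mule1 -(integral_normal_pdf m s) -ge0_integralZl_EFin//.
- apply: eq_integral => x _; rewrite -EFinM normal_pdfE//= /normal_fun s2.
  rewrite mulKf ?gt_eqF ?normal_peak_gt0//; congr (expR _)%:E.
  by field; rewrite gt_eqF.
- by move=> x _; rewrite lee_fin normal_pdf_ge0.
- by apply/measurable_EFinP; exact: measurable_normal_pdf.
- by rewrite peakE sqrtr_ge0.
Qed.

Lemma measurable_gauss (R : realType) (a m : R) :
  measurable_fun [set: measurableTypeR R] (fun x => expR (- (a * (x - m) ^+ 2))).
Proof.
apply: measurableT_comp => //; apply: measurableT_comp => //.
apply: measurable_funM => //; apply: measurable_funX => //.
exact: measurable_funB.
Qed.

(** * Truncated normal densities *)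

(** The point nearest to [m] in the closure of [half_line b]. *)
Definition half_line_proj (R : realType) (b : bool) (m : R) : R :=
  if b then Num.max m 0 else Num.min m 0.

(** The half-line contains a unit interval ending at the projection [c] of [m]. There
    [|x - m| <= |m - c| + 1], which bounds the density from below. *)
Lemma normal_prob_half_line_ge (R : realType) (b : bool) (m : R) :
  normal_peak 1 * expR (- (`|m - half_line_proj b m| + 1) ^+ 2 / 2) <=
  fine (normal_prob m 1 (half_line b)).
Proof.
set c := half_line_proj b m; set k := _ * _.
(* Open at [c], because [c] may be [0], which the half-line for [b = true] excludes. *)
pose I : set R := if b then `]c, (c + 1)[%classic else `](c - 1), c[%classic.
have mI : measurable (I : set (measurableTypeR R)).
  by rewrite /I; case: (b); exact: measurable_itv.
have mH : measurable (half_line b : set (measurableTypeR R)).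
  by rewrite /half_line; case: (b); exact: measurable_itv.
have muI : lebesgue_measure I = 1%E.
  rewrite /I; case: (b); rewrite lebesgue_measure_itv/= lte_fin.
    by rewrite ltrDl ltr01 -EFinB addrAC subrr add0r.
  by rewrite gtrBl ltr01 -EFinB opprB addrC subrK.
have k0 : 0 <= k by rewrite mulr_ge0 ?normal_peak_ge0 ?expR_ge0.
have subI : (I `<=` half_line b)%classic.
  rewrite /I /half_line /c /half_line_proj; case: (b) => x /=;
    rewrite !in_itv/= => /andP[h1 h2].
    by rewrite andbT (le_lt_trans _ h1)// le_max lexx orbT.
  by rewrite (le_trans (ltW h2))// ge_min lexx orbT.
have kI x : I x -> k <= normal_pdf m 1 x.
  rewrite normal_pdfE ?oner_neq0// => Ix.
  rewrite /k ler_wpM2l ?normal_peak_ge0// ler_expR expr1n !mulNr lerN2.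
  rewrite ler_wpM2r// -(real_normK (num_real (x - m))) lerXn2r ?nnegrE//.
  rewrite -(subrKA c) addrC (le_trans (ler_normD _ _))// distrC lerD2l.
  move: Ix; rewrite /I; case: (b) => /=; rewrite in_itv/= => /andP[h1 h2];
    rewrite ler_norml; lra.
rewrite -lee_fin fineK; last by rewrite fin_num_measure.
apply: (@le_trans _ _ (\int[lebesgue_measure]_(x in I) (normal_pdf m 1 x)%:E)%E).
  rewrite -[k%:E]mule1 -muI -integral_cst//.
  apply: ge0_le_integral => //.
  by apply/measurable_EFinP/measurable_funTS; exact: measurable_normal_pdf.
apply: ge0_subset_integral => //.
- by apply/measurable_EFinP/measurable_funTS; exact: measurable_normal_pdf.
- by move=> x _; rewrite lee_fin normal_pdf_ge0.
Qed.

Lemma trunc_normal_pdf_half_line_le (R : realType) (b : bool) (m x : R) :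
  trunc_normal_pdf m (half_line b) x <=
  expR (1 / 2 + `|m| - (x - half_line_proj b m) ^+ 2 / 2).
Proof.
rewrite /trunc_normal_pdf indicE.
have [|_] := boolP (x \in _); last by rewrite mulr0 expR_ge0.
rewrite inE mulr1 => xb.
have := normal_prob_half_line_ge b m; set c := half_line_proj b m.
set N := fine _ => kN.
have k0 : 0 < normal_peak (1 : R) by rewrite normal_peak_gt0 ?oner_neq0.
have N0 : 0 < N by apply: lt_le_trans kN; rewrite mulr_gt0 ?expR_gt0.
rewrite ler_pdivrMr// normal_pdfE ?oner_neq0//.
apply: le_trans (ler_wpM2l (expR_ge0 _) kN).
rewrite mulrCA ler_wpM2l ?(ltW k0)// -expRD ler_expR expr1n.
(* If [m] lies in the closed half-line, then [c = m] and this says [0 <= |m|]. Otherwise [c = 0] and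
   it reduces to [x * m <= 0], the signs being opposite. *)
have : - (x - m) ^+ 2 + (`|m - c| + 1) ^+ 2 <= 1 + `|m| *+ 2 - (x - c) ^+ 2.
  move: xb; rewrite /half_line /c /half_line_proj; case: (b) => /=;
    rewrite in_itv/= ?andbT => x0.
    have [m0|m0] := leP 0 m.
      by rewrite subrr normr0 mulr2n; have := normr_ge0 m; lra.
    by rewrite !subr0 ltr0_norm// mulr2n; nra.
  have [m0|m0] := leP m 0.
    by rewrite subrr normr0 mulr2n; have := normr_ge0 m; lra.
  by rewrite !subr0 gtr0_norm// mulr2n; nra.
by rewrite mulr2n; lra.
Qed.

Lemma trunc_normal_pdf_ge0 (R : realType) (m x : R) (A : set R) :
  measurable A -> 0 <= trunc_normal_pdf m A x.
Proof.
move=> mA; rewrite mulr_ge0// mulr_ge0 ?normal_pdf_ge0// invr_ge0.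
by rewrite fine_ge0// measure_ge0.
Qed.

(** * Dot products and quadratic forms *)

Definition bform (R : realType) n (P : 'M[R]_n) (x y : 'cV[R]_n) : R :=
  (x^T *m P *m y) 0 0.

Definition dotv (R : realType) n (x y : 'cV[R]_n) : R := (x^T *m y) 0 0.

Lemma dotvE (R : realType) n (x y : 'cV[R]_n) :
  dotv x y = \sum_i x i 0 * y i 0.
Proof. by rewrite /dotv mxE; apply: eq_bigr => i _; rewrite mxE. Qed.

Lemma dotv_ge0 (R : realType) n (x : 'cV[R]_n) : 0 <= dotv x x.
Proof. by rewrite dotvE sumr_ge0// => i _; rewrite -expr2 sqr_ge0. Qed.

Lemma bform1 (R : realType) n (x y : 'cV[R]_n) : bform 1%:M x y = dotv x y.
Proof. by rewrite /bform mulmx1. Qed.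

Lemma bformC (R : realType) n (P : 'M[R]_n) (x y : 'cV[R]_n) :
  P^T = P -> bform P x y = bform P y x.
Proof.
move=> Psym; rewrite /bform (_ : y^T *m P *m x = (x^T *m P *m y)^T) ?mxE//.
by rewrite !trmx_mul trmxK Psym mulmxA.
Qed.

(* AM-GM, from [0 <= (e x - y)^T P (e x - y)]. *)
Lemma bform_le (R : realType) n (P : 'M[R]_n) (e : R) (x y : 'cV[R]_n) :
  P^T = P -> (forall u, 0 <= bform P u u) -> 0 < e ->
  bform P x y *+ 2 <= e * bform P x x + e^-1 * bform P y y.
Proof.
move=> Psym P0 e0.
have expand : bform P (e *: x - y) (e *: x - y) =
    e * (e * bform P x x + e^-1 * bform P y y - bform P x y *+ 2).
  rewrite mulrBr mulrDr mulVKf ?gt_eqF// mulr2n {2}(bformC _ _ Psym) /bform.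
  have -> : (e *: x - y)^T = e *: x^T - y^T by rewrite linearB/= linearZ.
  rewrite !(mulmxBl, mulmxBr) -!scalemxAl -!scalemxAr !mxE.
  by ring.
by have := P0 (e *: x - y); rewrite expand pmulr_rge0// subr_ge0.
Qed.

(** Cauchy-Schwarz by Lagrange's identity: twice the difference is the double sum of the squares of
    [a i * x j - a j * x i]. *)
Lemma sqr_sum_mul_le (R : realType) n (a x : 'I_n -> R) :
  (\sum_i a i * x i) ^+ 2 <= (\sum_i a i ^+ 2) * (\sum_i x i ^+ 2).
Proof.
rewrite expr2 !big_distrlr/= -(@ler_pMn2r _ 2)// mulr2n [leRHS]mulr2n.
rewrite [X in _ <= _ + X]exchange_big/= -!big_split/=.
apply: ler_sum => i _; rewrite -!big_split/=; apply: ler_sum => j _.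
by have := sqr_ge0 (a i * x j - a j * x i); nra.
Qed.

Lemma dotv_mulmx_le (R : realType) m n (A : 'M[R]_(m, n)) :
  exists2 C : R, 0 <= C & forall x, dotv (A *m x) (A *m x) <= C * dotv x x.
Proof.
(* The squared Frobenius norm works, by Cauchy-Schwarz on each row. *)
exists (\sum_i \sum_j A i j ^+ 2).
  by apply: sumr_ge0 => i _; apply: sumr_ge0 => j _; exact: sqr_ge0.
move=> x; rewrite !dotvE mulr_suml; apply: ler_sum => i _.
by rewrite mxE -expr2; under [X in _ * X]eq_bigr do rewrite -expr2;
  exact: sqr_sum_mul_le.
Qed.

(** A nonzero row of the kernel would make the quadratic form vanish. *)
Lemma spdmx_unit (R : realType) n (P : 'M[R]_n) : spdmx P -> P \in unitmx.
Proof.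
move=> [Psym Ppos]; rewrite -row_free_unit -kermx_eq0; apply/eqP/row_matrixP => i.
rewrite row0; apply: contraTeq isT => ki.
have /Ppos : (row i (kermx P))^T != 0 by rewrite trmx_eq0.
by rewrite trmxK -row_mul mulmx_ker row0 mul0mx mxE ltxx.
Qed.

Definition proj_half_lines (R : realType) n (y : n.-tuple bool) (u : 'cV[R]_n) :=
  \col_i half_line_proj (tnth y i) (u i 0).

Lemma dotvDr (R : realType) n (x y z : 'cV[R]_n) :
  dotv x (y + z) = dotv x y + dotv x z.
Proof. by rewrite /dotv mulmxDr mxE. Qed.

Lemma dotvBr (R : realType) n (x y z : 'cV[R]_n) :
  dotv x (y - z) = dotv x y - dotv x z.
Proof. by rewrite /dotv mulmxBr mxE [X in _ + X]mxE. Qed.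

Lemma dotv_mulmxr (R : realType) m n (A : 'M[R]_(m, n)) x y :
  dotv x (A *m y) = dotv (A^T *m x) y.
Proof. by rewrite /dotv trmx_mul trmxK mulmxA. Qed.

Lemma bformE (R : realType) n (P : 'M[R]_n) (x y : 'cV[R]_n) :
  bform P x y = dotv x (P *m y).
Proof. by rewrite /bform /dotv mulmxA. Qed.

(** Each coordinate is either fixed by the projection or sent to 0, so it contributes 0 or
    [u_i^2]. *)
Lemma dotv_sub_proj_ge0 (R : realType) n (y : n.-tuple bool) (u : 'cV[R]_n) :
  0 <= dotv u (u - proj_half_lines y u).
Proof.
rewrite dotvE sumr_ge0// => i _; rewrite !mxE /half_line_proj.
case: ifP => _.
  by have [m0|m0] := leP 0 (u i 0); nra.
by have [m0|m0] := leP (u i 0) 0; nra.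
Qed.

Lemma spdmx_bform_ge0 (R : realType) n (P : 'M[R]_n) (u : 'cV[R]_n) :
  spdmx P -> 0 <= bform P u u.
Proof.
move=> [_ Ppos]; have [->|/Ppos/ltW//] := eqVneq u 0.
by rewrite /bform mulmx0 mxE.
Qed.

Lemma bform_gram_add (R : realType) n p (X : 'M[R]_(n, p)) (Q : 'M[R]_p)
    (b b' : 'cV[R]_p) :
  bform (X^T *m X + Q) b b' = dotv (X *m b) (X *m b') + bform Q b b'.
Proof. by rewrite /bform /dotv mulmxDr mulmxDl mxE trmx_mul !mulmxA. Qed.

Lemma spdmx_gram_add (R : realType) n p (X : 'M[R]_(n, p)) (Q : 'M[R]_p) :
  spdmx Q -> spdmx (X^T *m X + Q).
Proof.
move=> [Qsym Qpos]; split; first by rewrite linearD/= trmx_mul trmxK Qsym.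
move=> u u0; rewrite -/(bform _ _ _) bform_gram_add.
by rewrite ltr_wpDl ?dotv_ge0 ?Qpos.
Qed.

Lemma dotv_le (R : realType) n (e : R) (x y : 'cV[R]_n) : 0 < e ->
  dotv x y *+ 2 <= e * dotv x x + e^-1 * dotv y y.
Proof.
move=> e0; rewrite -!bform1; apply: bform_le => //; first exact: trmx1.
by move=> u; rewrite bform1 dotv_ge0.
Qed.

(** * Coercivity of the exponent *)

Section coercivity.
Variables (R : realType) (n p : nat) (X : 'M[R]_(n, p)) (y : n.-tuple bool).
Variables (Q S : 'M[R]_p) (v : 'cV[R]_p).
Hypotheses (Qspd : spdmx Q) (SP : is_invsqrtmx Q S).
Let P := X^T *m X + Q.

(** Deviation of [b] from its conditional mean given [z]. *)
Let resid (z : 'cV[R]_n) (b : 'cV[R]_p) := b - invmx P *m (v + X^T *m z).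

(** Since [P b = X^T u + Q b], the vector [P (resid z b)] is [X^T (u - z) + Q b - v]; pair it with
    [b]. Apart from [dotv b v], the right side is linear in the two residuals to be bounded
    below. *)
Lemma bform_resid z b (u := X *m b) (w := proj_half_lines y u) :
  bform Q b b + dotv u (u - w) =
  bform P b (resid z b) + dotv b v + dotv u (z - w).
Proof.
have PV : P *m invmx P = 1%:M by rewrite mulmxV// spdmx_unit//; exact: spdmx_gram_add.
have Presid : P *m resid z b = X^T *m (u - z) + Q *m b - v.
  rewrite /resid mulmxBr mulmxA PV mul1mx /P mulmxDl -mulmxA mulmxBr -/u opprD.
  by rewrite -!addrA; congr (_ + _); rewrite [RHS]addrCA [- v + _]addrC.
have -> : bform P b (resid z b) = dotv u (u - z) + bform Q b b - dotv b v.
  rewrite bformE Presid dotvBr dotvDr (@dotv_mulmxr _ _ _ X^T) trmxK.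
  by rewrite (bformE Q).
by rewrite !dotvBr; ring.
Qed.

Lemma coercivity : exists2 c : R, 0 < c & exists K : R, forall z b,
  c * dotv b b - K <= bform P (resid z b) (resid z b) +
    dotv (z - proj_half_lines y (X *m b)) (z - proj_half_lines y (X *m b)).
Proof.
have [Sspd SS] := SP; have [Ssym _] := Sspd.
have SQS : S *m Q *m S = 1%:M.
  by apply: mulmx1C; rewrite mulmxA SS mulVmx// spdmx_unit.
have [C1 C10 XS_le] := dotv_mulmx_le (X *m S).
have [C2 C20 S_le] := dotv_mulmx_le S.
(* Chosen so that [2 e (U + G) <= G] once [U <= C1 * G]: the AM-GM terms then absorb only half of
   [2 G]. *)
pose e : R := (C1 + 1)^-1 / 2.
have e0 : 0 < e by rewrite divr_gt0// invr_gt0 ltr_wpDl.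
have C2e : 0 < C2 + 1 by rewrite ltr_wpDl.
(* The [+ 1] keeps the divisor positive when [C2 = 0]. *)
exists (e / (C2 + 1)); first by rewrite divr_gt0.
exists (dotv (S *m v) (S *m v)) => z b.
set s := resid z b; set w := proj_half_lines _ _.
(* In the coordinates [g] the form of [Q] becomes the squared Euclidean norm. *)
pose g := invmx S *m b; have bE : b = S *m g by rewrite mulKVmx// spdmx_unit.
set V := dotv (S *m v) _; set A := bform P s s; set T := dotv (z - w) _.
pose G := dotv g g; pose U := dotv (X *m b) (X *m b).
have QG : bform Q b b = G.
  rewrite /bform bE trmx_mul Ssym -!mulmxA (mulmxA Q) (mulmxA S) mulmxA.
  by rewrite (mulmxA S) SQS mulmx1.
have PG : bform P b b = U + G by rewrite bform_gram_add QG.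
have UG : U <= C1 * G by rewrite /U bE mulmxA XS_le.
have BG : dotv b b <= C2 * G by rewrite bE S_le.
have bv : dotv b v = dotv g (S *m v) by rewrite /dotv bE trmx_mul Ssym mulmxA.
have Pspd : spdmx P := spdmx_gram_add X Qspd.
have := bform_le b s (proj1 Pspd) (fun u => spdmx_bform_ge0 u Pspd) e0.
have := dotv_le g (S *m v) e0; have := dotv_le (X *m b) (z - w) e0.
rewrite -/A -/V -/T -/U -/G PG -bv => uz gv bs.
have H : G <= bform P b s + dotv b v + dotv (X *m b) (z - w).
  by rewrite -bform_resid QG lerDl dotv_sub_proj_ge0.
(* Sum of the AM-GM bounds for the pairs [(b, s)], [(g, S v)] and [(X b, z - w)]. *)
have {H bs gv uz} H : G *+ 2 <= e * ((U + G) + G + U) + e^-1 * (A + V + T).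
  by rewrite !mulrDr; move: bs gv uz H; rewrite !mulr2n; lra.
have {}H : e * G <= A + V + T.
  have eG : e * ((U + G) + G + U) <= G.
    rewrite /e -mulrA ler_pdivrMl ?ltr_wpDl//; lra.
  rewrite -ler_pdivlMl//.
  by move: H; rewrite mulr2n => H; lra.
have : e / (C2 + 1) * dotv b b <= e * G.
  rewrite mulrAC ler_pdivrMr// -[leRHS]mulrA ler_wpM2l ?(ltW e0)//.
  by have := dotv_ge0 g; rewrite -/G; lra.
lra.
Qed.
End coercivity.

(** * Gaussian domination of the integrand *)

Section kernel_bound.
Variables (R : realType) (n p : nat) (X : 'M[R]_(n, p)) (y : n.-tuple bool).
Variables (Q S : 'M[R]_p) (v : 'cV[R]_p).
Hypotheses (Qspd : spdmx Q) (SP : is_invsqrtmx Q S).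

Lemma measurable_half_line (b : bool) :
  measurable (half_line b : set (measurableTypeR R)).
Proof. by rewrite /half_line; case: b; exact: measurable_itv. Qed.

Lemma latent_pdf_le (b : 'cV[R]_p) (z : 'cV[R]_n) (u := X *m b) :
  latent_pdf X y b z <=
  expR (n%:R / 2 + \sum_i `|u i 0| -
        dotv (z - proj_half_lines y u) (z - proj_half_lines y u) / 2).
Proof.
apply: (@le_trans _ _ (\prod_i expR (1 / 2 + `|u i 0| -
    (z i 0 - half_line_proj (tnth y i) (u i 0)) ^+ 2 / 2))).
  apply: ler_prod => i _; rewrite trunc_normal_pdf_half_line_le.
  by rewrite trunc_normal_pdf_ge0//; exact: measurable_half_line.
rewrite -expR_sum ler_expR !big_split/= sumr_const card_ord.
rewrite mul1r -[2^-1 *+ n]mulr_natl sumrN dotvE mulr_suml lerD2l lerN2.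
by apply: ler_sum => i _; rewrite !mxE expr2.
Qed.

(** The linear growth left by the truncation masses costs an arbitrarily small quadratic term; this
    follows from [(d t - 1/2)^2 >= 0]. *)
Lemma sum_norm_le (u : 'cV[R]_n) (d : R) : 0 < d ->
  \sum_i `|u i 0| <= d * dotv u u + n%:R * d^-1.
Proof.
move=> d0; rewrite dotvE mulr_sumr mulr_natl -[X in _ *+ X]card_ord -sumr_const.
rewrite -big_split/=; apply: ler_sum => i _.
rewrite -expr2 -real_normK ?num_real//; set t := `|_|.
rewrite -(ler_pM2l d0) mulrDr mulfV ?gt_eqF//.
by have := sqr_ge0 (d * t - 1 / 2); lra.
Qed.

Lemma acda_integrand_le :
  exists2 a : R, 0 < a & exists2 k : R, 0 <= k & forall z b,
    Defs.beta_pdf X Q v z b * latent_pdf X y b z <=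
    k * expR (- (a * dotv b b)) *
    expR (- (4^-1 * dotv (z - proj_half_lines y (X *m b))
                         (z - proj_half_lines y (X *m b)))).
Proof.
have [c c0 [K cK]] := coercivity X y v Qspd SP.
have [C C0 X_le] := dotv_mulmx_le X.
have C1 : 0 < C + 1 by rewrite ltr_wpDl.
(* Makes [d |X b|^2 <= (c / 8) |b|^2]. A quarter of the coercivity bound gives [(c / 4) |b|^2], so
   [c / 8] survives. *)
pose d := c / 8 / (C + 1).
have d0 : 0 < d by rewrite !divr_gt0.
pose N := Num.sqrt ((2 * pi) ^+ p * \det (invmx (X^T *m X + Q))).
exists (c / 8); first by rewrite divr_gt0.
exists (N^-1 * expR (K / 4 + n%:R / 2 + n%:R * d^-1)).
  by rewrite mulr_ge0 ?expR_ge0// invr_ge0 sqrtr_ge0.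
move=> z b; have := cK z b; set s := b - _; set T := dotv (z - _) _ => cKzb.
rewrite /Defs.beta_pdf /mvnormal_pdf -/s -/N invmxK -/(bform _ s s).
rewrite -!mulrA [leLHS]mulrCA ler_wpM2l ?invr_ge0 ?sqrtr_ge0//.
apply: le_trans (ler_wpM2l (expR_ge0 _) (latent_pdf_le b z)) _.
rewrite -!expRD ler_expR -/T.
have := sum_norm_le (X *m b) d0; have := X_le b.
have : d * dotv (X *m b) (X *m b) <= c / 8 * dotv b b.
  rewrite /d mulrAC ler_pdivrMr// -[leRHS]mulrA ler_wpM2l ?divr_ge0 ?(ltW c0)//.
  by have := X_le b; have := dotv_ge0 b; lra.
(* With [A = s^T P s >= 0], [(A + T) / 2 >= (A + T) / 4 + T / 4]: coercivity handles the first term,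
   the second is kept for the integral in [z]. *)
have := spdmx_bform_ge0 s (spdmx_gram_add X Qspd).
move: cKzb; lra.
Qed.
End kernel_bound.

(** * Integration of the bound *)

(** The value does not depend on [w], so the centre may vary with [b] when [z] is integrated
    first. *)
Lemma integral_gauss_tuple (R : realType) n (a : R) (w : 'cV[R]_n) : 0 < a ->
  (\int[lebesgue_tuple n]_t
     (expR (- (a * dotv (col_of_tuple t - w) (col_of_tuple t - w))))%:E =
   (Num.sqrt (pi / a) ^+ n)%:E)%E.
Proof.
move=> a0; rewrite -(@integral_lebesgue_tuple_prod _ _
  (fun i x => expR (- (a * (x - w i 0) ^+ 2))))//.
- apply: eq_integral => t _; rewrite -expR_sum dotvE mulr_sumr -sumrN.
  by congr (expR _)%:E; apply: eq_bigr => i _; rewrite !mxE expr2.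
- by move=> i; exact: measurable_gauss.
- by move=> i; exact: integral_gauss_pos.
Qed.

Lemma measurable_gauss_tuple (R : realType) n (a : R) (w : 'cV[R]_n) :
  measurable_fun setT (fun t : n.-tuple (measurableTypeR R) =>
     expR (- (a * dotv (col_of_tuple t - w) (col_of_tuple t - w)))).
Proof.
have := measurable_prod_tnth (fun i : 'I_n => measurable_gauss a (w i 0)).
congr measurable_fun; apply/funext => t; rewrite -expR_sum dotvE mulr_sumr -sumrN.
by congr expR; apply: eq_bigr => i _; rewrite !mxE expr2.
Qed.

Lemma acda_trace_class (R : realType) (n p : nat) (y : n.-tuple bool)
    (Q S : 'M[R]_p) (v : 'cV[R]_p) (X : 'M[R]_(n, p)) :
  spdmx Q -> is_invsqrtmx Q S -> trace_class (acda_kernel X y Q v).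
Proof.
move=> Qspd SP; have [a a0 [k k0 bound]] := acda_integrand_le X y v Qspd SP.
have integrand_ge0 z b : 0 <= Defs.beta_pdf X Q v z b * latent_pdf X y b z.
  rewrite mulr_ge0 ?mulr_ge0 ?expR_ge0 ?invr_ge0 ?sqrtr_ge0//.
  rewrite prodr_ge0// => i _; apply: trunc_normal_pdf_ge0.
  exact: measurable_half_line.
pose M := Num.sqrt (pi / 4^-1 : R) ^+ n.
have M0 : 0 <= M by rewrite exprn_ge0 ?sqrtr_ge0.
(* The bound after integrating out [z]; the subtraction of [0] gives it the centred shape of
   [integral_gauss_tuple]. *)
pose h (t : p.-tuple (measurableTypeR R)) : R :=
  k * M * expR (- (a * dotv (col_of_tuple t - 0) (col_of_tuple t - 0))).
apply: (@le_lt_trans _ _ (\int[lebesgue_tuple p]_t (h t)%:E)%E).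
  apply: ge0_le_integral_nomeas => [t _|t|t _].
  - by apply: integral_ge0 => z _; rewrite lee_fin.
  - by rewrite lee_fin mulr_ge0 ?expR_ge0// mulr_ge0.
  rewrite /acda_kernel; set b := col_of_tuple t.
  pose g (z : n.-tuple (measurableTypeR R)) : R :=
    k * expR (- (a * dotv b b)) *
    expR (- (4^-1 * dotv (col_of_tuple z - proj_half_lines y (X *m b))
                         (col_of_tuple z - proj_half_lines y (X *m b)))).
  have kb0 : 0 <= k * expR (- (a * dotv b b)) by rewrite mulr_ge0 ?expR_ge0.
  (* The domain grows from the latent space to all of [R^n], where the Gaussian factorizes. *)
  apply: (@le_trans _ _ (\int[lebesgue_tuple n]_z (g z)%:E)%E).
    apply: ge0_le_integral_nomeas => [z _|z|z _]; rewrite lee_fin//.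
    by rewrite mulr_ge0 ?expR_ge0.
  rewrite /g; under eq_integral do rewrite EFinM.
  rewrite ge0_integralZl_EFin//.
  - rewrite integral_gauss_tuple ?invr_gt0// -/M -EFinM lee_fin /h subr0.
    by rewrite -!mulrA [X in _ * X]mulrC.
  - by apply/measurable_EFinP; exact: measurable_gauss_tuple.
rewrite /h; under eq_integral do rewrite EFinM.
rewrite ge0_integralZl_EFin//.
- by rewrite integral_gauss_tuple// -EFinM ltry.
- by apply/measurable_EFinP; exact: measurable_gauss_tuple.
- by rewrite mulr_ge0.
Qed.

Theorem theorem2 (R : realType) (n p : nat) (hn : (0 < n)%N) (hp : (0 < p)%N)
  (y : n.-tuple bool) (Q : 'M[R]_p) (v : 'cV[R]_p) (X : 'M[R]_(n, p))
  (Qspd : spdmx Q)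
  (Xrank : if (p <= n)%N then \rank X = p else \rank X = n)
  (Qinvsqrt : 'M[R]_p) (QinvsqrtP : is_invsqrtmx Q Qinvsqrt)
  (hAB :
     (if (p <= n)%N then
        forall a : R,
          eigenvalue (Qinvsqrt *m X^T *m X *m Qinvsqrt) a -> a < 7 / 2
      else
        forall a : R,
          eigenvalue (Qinvsqrt *m X^T *m X *m Qinvsqrt) a ->
          a != 0 -> a < 7 / 2)
     \/ rect_diagonal (X *m Qinvsqrt)) :
  trace_class (acda_kernel X y Q v).
Proof. exact: acda_trace_class QinvsqrtP. Qed.
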